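(* For each odd integer $p\ge 3$, the Hecke group $\Gamma=\Delta(p,2,\infty)=\langle X,Y,Z\mid X^p=Y^2=XYZ=1\rangle\cong C_p*C_2$ has uncountably many conjugacy classes of torsion-free maximal subgroups, each freely generated by a countably infinite set of parabolic elements of $\Gamma$.
   Context: The parabolic elements of $\Gamma=\langle X,Y,Z\mid X^p=Y^2=XYZ=1\rangle$ are the conjugates in $\Gamma$ of the non-identity powers of $Z$. A maximal subgroup is a maximal proper subgroup. *)

(* Defs.v *)
From HB Require Import structures.
From mathcomp Require Import all_boot all_order all_algebra.
From mathcomp Require Import all_classical.

Set Implicit Arguments.
Unset Strict Implicit.
Unset Printing Implicit Defensive.

Local Open Scope quotient_scope.
Local Open Scope classical_set_scope.
Local Open Scope group_scope.

(* The letter (s, false) stands for the generator s, (s, true) for s^-1. *)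
Definition word (S : Type) := seq (S * bool).

Inductive pres_eq (S : Type) (R : set (word S)) : word S -> word S -> Prop :=
| pres_refl u : pres_eq R u u
| pres_sym u v : pres_eq R u v -> pres_eq R v u
| pres_trans v u w : pres_eq R u v -> pres_eq R v w -> pres_eq R u w
| pres_cancel u v s b :
    pres_eq R (u ++ [:: (s, b); (s, ~~ b)] ++ v) (u ++ v)
| pres_relator u v r : R r -> pres_eq R (u ++ r ++ v) (u ++ v).

Section PresentedGroup.
Variables (S : choiceType) (R : set (word S)).
Implicit Types u v w : seq (S * bool).

Definition pres_rel : rel (seq (S * bool)) := fun u v => `[< pres_eq R u v >].

Lemma pres_rel_refl : reflexive pres_rel.
Proof. by move=> u; apply/asboolP; exact: pres_refl. Qed.

Lemma pres_rel_sym : symmetric pres_rel.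
Proof. by move=> u v; apply/asboolP/asboolP; exact: pres_sym. Qed.

Lemma pres_rel_trans : transitive pres_rel.
Proof.
move=> v u w /asboolP uv /asboolP vw.
by apply/asboolP; exact: pres_trans uv vw.
Qed.

Canonical pres_equiv :=
  EquivRel pres_rel pres_rel_refl pres_rel_sym pres_rel_trans.

(* The group < S | R >. *)
Definition presented := {eq_quot pres_rel}.
HB.instance Definition _ := Choice.on presented.
HB.instance Definition _ := EqQuotient.on presented.

Definition pres_class (u : word S) : presented := \pi_presented u.
Definition pres_gen (s : S) : presented := pres_class [:: (s, false)].

Lemma pres_classP u v : pres_class u = pres_class v <-> pres_eq R u v.
Proof.
split=> [/eqP|uv]; last by apply/eqP; rewrite eqmodE; apply/asboolP.
by rewrite eqmodE => /asboolP.
Qed.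

Lemma pres_reprK (x : presented) : pres_class (repr x) = x.
Proof. exact: reprK. Qed.

Lemma pres_eq_catl w u v : pres_eq R u v -> pres_eq R (w ++ u) (w ++ v).
Proof.
elim=> {u v} [u|u v _|v u t _ IH1 _|u v s b|u v r Rr].
- exact: pres_refl.
- exact: pres_sym.
- exact: pres_trans IH1.
- by rewrite !(catA w); exact: pres_cancel.
- by rewrite !(catA w); exact: pres_relator.
Qed.

Lemma pres_eq_catr w u v : pres_eq R u v -> pres_eq R (u ++ w) (v ++ w).
Proof.
elim=> {u v} [u|u v _|v u t _ IH1 _|u v s b|u v r Rr].
- exact: pres_refl.
- exact: pres_sym.
- exact: pres_trans IH1.
- by rewrite -!catA; exact: pres_cancel.
- by rewrite -!catA; exact: pres_relator.
Qed.

Definition word_inv (u : word S) : word S :=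
  rev [seq (a.1, ~~ a.2) | a <- u].

Lemma word_inv_cons a u : word_inv (a :: u) = word_inv u ++ [:: (a.1, ~~ a.2)].
Proof. by rewrite /word_inv /= rev_cons -cats1. Qed.

Lemma word_inv_cat u v : word_inv (u ++ v) = word_inv v ++ word_inv u.
Proof. by rewrite /word_inv map_cat rev_cat. Qed.

Lemma word_invK u : word_inv (word_inv u) = u.
Proof.
rewrite /word_inv map_rev revK -map_comp -[RHS]map_id.
by apply: eq_map => -[s b] /=; rewrite negbK.
Qed.

Lemma pres_mulV u : pres_eq R (u ++ word_inv u) [::].
Proof.
elim: u => [|[s b] u IH]; first exact: pres_refl.
rewrite word_inv_cons /=; set t := [:: (s, ~~ b)].
have := pres_eq_catl [:: (s, b)] (pres_eq_catr t IH).
rewrite -catA /= => /pres_trans; apply.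
exact: (pres_cancel R [::] [::] s b).
Qed.

Lemma pres_Vmul u : pres_eq R (word_inv u ++ u) [::].
Proof. by have := pres_mulV (word_inv u); rewrite word_invK. Qed.

Lemma pres_eq_inv u v : pres_eq R u v -> pres_eq R (word_inv u) (word_inv v).
Proof.
move=> uv.
have := pres_eq_catl (word_inv u) (pres_eq_catr (word_inv v) uv).
rewrite catA => Huv.
have := pres_eq_catl (word_inv u) (pres_mulV v); rewrite cats0 => /pres_sym Hu.
apply: pres_trans Hu _; apply: pres_trans (pres_sym Huv) _.
exact: pres_eq_catr (pres_Vmul u).
Qed.

Definition pres_mul (x y : presented) := pres_class (repr x ++ repr y).
Definition pres_one := pres_class [::].
Definition pres_inv (x : presented) := pres_class (word_inv (repr x)).

Lemma pres_mul_class u v :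
  pres_mul (pres_class u) (pres_class v) = pres_class (u ++ v).
Proof.
apply/pres_classP; apply: (@pres_trans _ _ (u ++ repr (pres_class v))).
  by apply/pres_eq_catr/pres_classP/pres_reprK.
by apply/pres_eq_catl/pres_classP/pres_reprK.
Qed.

Lemma pres_inv_class u : pres_inv (pres_class u) = pres_class (word_inv u).
Proof. by apply/pres_classP/pres_eq_inv/pres_classP/pres_reprK. Qed.

Lemma pres_mulA : associative pres_mul.
Proof.
move=> x y z; rewrite -[x]pres_reprK -[y]pres_reprK -[z]pres_reprK.
by rewrite !pres_mul_class catA.
Qed.

Lemma pres_mul1g : left_id pres_one pres_mul.
Proof. by move=> x; rewrite -[x]pres_reprK pres_mul_class. Qed.

Lemma pres_mulg1 : right_id pres_one pres_mul.
Proof. by move=> x; rewrite -[x]pres_reprK pres_mul_class cats0. Qed.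

Lemma pres_mulVg : left_inverse pres_one pres_inv pres_mul.
Proof.
move=> x; rewrite -[x]pres_reprK pres_inv_class pres_mul_class.
exact/pres_classP/pres_Vmul.
Qed.

Lemma pres_mulgV : right_inverse pres_one pres_inv pres_mul.
Proof.
move=> x; rewrite -[x]pres_reprK pres_inv_class pres_mul_class.
exact/pres_classP/pres_mulV.
Qed.

HB.instance Definition _ := isGroup.Build presented
  pres_mulA pres_mul1g pres_mulg1 pres_mulVg pres_mulgV.

End PresentedGroup.

Definition free_group (S : choiceType) : groupType := presented (@set0 (word S)).

(* Presented by the disjoint union of the multiplication tables. *)
Definition free_product (G H : groupType) : groupType :=
  presented ([set w : word (G + H)%type | exists x y : G,
       w = [:: (inl x, false); (inl y, false); (inl (x * y), true)]] `|`
     [set w | exists x y : H,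
       w = [:: (inr x, false); (inr y, false); (inr (x * y), true)]]).

(* Z/nZ for n > 1; the law of the groupType structure of 'Z_n is addition. *)
Definition cyclic_group (n : nat) : groupType := 'Z_n.

Definition isomorphic (G H : groupType) : Prop :=
  exists f : {multiplicative G -> H}, bijective f.

Section Subgroups.
Variable G : groupType.
Implicit Types M K T : set G.

Definition subgroup K : Prop := group_closed (mem K).

Definition maximal_subgroup M : Prop :=
  [/\ subgroup M, M <> setT &
      forall K, subgroup K -> M `<=` K -> K = M \/ K = setT].

Definition torsion_free M : Prop :=
  forall x, M x -> forall n : nat, x ^+ n.+1 = 1 -> x = 1.

(* The homomorphism from the free group on T to G extending the inclusion
   of T is injective with image M. *)
Definition freely_generated M T : Prop :=
  exists f : {multiplicative free_group T -> G},
    [/\ forall t : T, f (pres_gen set0 t) = set_val t, injective f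
      & range f = M].

Definition conjugacy_class M : set (set G) :=
  [set [set x ^ g | x in M] | g in [set: G]].

End Subgroups.

Variant hecke_gen := HX | HY | HZ.
HB.instance Definition _ := gen_eqMixin hecke_gen.
HB.instance Definition _ := gen_choiceMixin hecke_gen.

Definition hecke_relators (p : nat) : set (word hecke_gen) :=
  [set nseq p (HX, false);
       [:: (HY, false); (HY, false)];
       [:: (HX, false); (HY, false); (HZ, false)]].

Definition hecke (p : nat) : groupType := presented (hecke_relators p).

Definition heckeZ (p : nat) : hecke p := pres_gen (hecke_relators p) HZ.

Definition hecke_parabolic (p : nat) : set (hecke p) :=
  [set x | exists z g : hecke p,
    [/\ exists n : nat, z = heckeZ p ^+ n \/ z = heckeZ p ^- n,
        z <> 1 & x = z ^ g]].

(* Main.v *)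
Require Import Defs.
From HB Require Import structures.
From mathcomp Require Import all_boot all_order all_algebra.
From mathcomp Require Import all_classical.
From mathcomp Require Import zify.

Set Implicit Arguments.
Unset Strict Implicit.
Unset Printing Implicit Defensive.

Local Open Scope classical_set_scope.
Local Open Scope card_scope.
Local Open Scope group_scope.

(** Why there are so many such subgroups.

    Write Gamma = <X, Y>, so that Z is the inverse of X Y.  Transitive actions
    of Gamma in which X has only p-cycles and Y only 2-cycles are p-valent
    graphs drawn on oriented surfaces: the points are the darts (half-edges),
    X turns a dart around its vertex, Y exchanges the two halves of an edge,
    and the orbits of Z are the faces.  The point stabiliser M is the
    fundamental group of the graph.  The graphs used here are infinite planar
    trees to which loops are attached so as to make them p-valent, the two
    halves of each loop being consecutive around its vertex.  Each loop then
    encloses a face of length 1, that is a fixed point of Z, and everything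
    below comes from that.

    - M is free on parabolic elements.  Walk from the base point to a loop
      along the tree, go round the loop, and walk back: the result is a
      conjugate of Z.  These elements generate M by the usual spanning tree
      argument ([loop_elts_generate]).  They are free because Gamma also acts
      on the product of the darts with the free group on the loops, recording
      which loops have been traversed ([skew_loop_elt], [stabiliser_free]).
      As a free group, M is torsion-free ([free_torsion_free]).

    - M is maximal, that is, the action is primitive, as soon as the darts not
      fixed by Z form a single orbit O of Z and the walk along O meets
      arbitrarily long runs without loops ([invariant_relation_full]).  Let e
      be an invariant equivalence relation other than equality.  If some class
      contains both a fixed point of Z and a point of O, then it contains O,
      is stable under X, and is everything.  Otherwise there are two distinct
      equivalent fixed points a and b; then X a and X b are equivalent points
      of O, so the classes of e in O are periodic along the walk, and the
      whole class of X a consists of images under X of fixed points.  A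
      periodic set cannot avoid runs longer than its period.

    - A one-ended planar tree has only one infinite face.  The trees taken
      here are caterpillars, with an infinite spine and one leaf at each spine
      vertex, planted on the left or on the right according to a binary
      sequence eps (a finite leaf vertex closes the lower end of the spine).
      Where eps keeps the value true, the walk along the face climbs the spine
      without meeting a loop.  The subgroup determines eps, because words of Gamma can explore the spine
      step by step ([caterpillar_group_inj]), so there are uncountably many
      subgroups ([sparse]); Gamma being countable, a conjugacy class contains
      only countably many of them.

    That p is odd is what lets every vertex have an odd number of tree edges,
    1 at a leaf and 3 on the spine, all other darts being paired into loops. *)

(** * Presented groups *)

Section GroupHom.
Variables (G H : groupType) (f : {multiplicative G -> H}).

Lemma mult_hom1 : f 1 = 1.
Proof. by apply: (mulgI (f 1)); rewrite -gmulfM !mulg1. Qed.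

Lemma mult_homV : {morph f : x / x^-1}.
Proof. by move=> x; apply: (mulgI (f x)); rewrite -gmulfM !mulgV mult_hom1. Qed.

Lemma mult_homX n : {morph f : x / x ^+ n}.
Proof.
by move=> x; elim: n => [|n IH]; rewrite ?mult_hom1 // !expgS gmulfM IH.
Qed.

End GroupHom.

(** The group structure of [presented R] as a [groupType]; homomorphisms are
    stated from it so that the group lemmas apply to them. *)
Definition pres_group (S : choiceType) (R : set (word S)) : groupType :=
  presented R.

Section PresentedTheory.
Variables (S : choiceType) (R : set (word S)).
Local Notation P := (pres_group R).

Lemma pres_classM u v :
  pres_class R (u ++ v) = (pres_class R u : P) * (pres_class R v : P).
Proof. by rewrite -pres_mul_class. Qed.

Lemma pres_classV u : pres_class R (word_inv u) = (pres_class R u : P)^-1.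
Proof. by rewrite -pres_inv_class. Qed.

Lemma pres_class_gen a :
  pres_class R [:: a] =
    if a.2 then (pres_gen R a.1 : P)^-1 else pres_gen R a.1.
Proof. by case: a => s [] //=; rewrite -pres_classV. Qed.

Lemma pres_ind (Q : P -> Prop) :
    Q 1 -> (forall g s, Q g -> Q (g * (pres_gen R s : P))) ->
    (forall g s, Q g -> Q (g * (pres_gen R s : P)^-1)) ->
  forall g, Q g.
Proof.
move=> Q1 QM QV g; rewrite -[g]pres_reprK.
elim/last_ind: (repr g) => [//|u a IH].
rewrite -cats1 pres_classM pres_class_gen.
by case: ifP => _; [exact: QV|exact: QM].
Qed.

Variables (G : groupType) (h : S -> G).

Definition word_eval (u : word S) : G :=
  \prod_(a <- u) (if a.2 then (h a.1)^-1 else h a.1).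

Hypothesis hR : forall r, R r -> word_eval r = 1.

Lemma word_eval_pres u v : pres_eq R u v -> word_eval u = word_eval v.
Proof.
elim=> {u v} // [u v w _ -> _ -> //|u v s b|u v r /hR].
- rewrite /word_eval !big_cat big_cons big_seq1 /=.
  by case: b => /=; rewrite ?mulVg ?mulgV mul1g.
- by rewrite /word_eval !big_cat /= => ->; rewrite mul1g.
Qed.

Definition pres_lift (g : P) : G := word_eval (repr g).

Lemma pres_lift_class u : pres_lift (pres_class R u) = word_eval u.
Proof. exact/word_eval_pres/pres_classP/pres_reprK. Qed.

Lemma pres_liftM : {morph pres_lift : g k / g * k}.
Proof.
move=> g k; rewrite -[g]pres_reprK -[k]pres_reprK -pres_classM.
by rewrite !pres_lift_class /word_eval big_cat.
Qed.

(** The universal property of [presented R]. *)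
Lemma pres_lift_exists :
  exists f : {multiplicative P -> G}, forall s, f (pres_gen R s) = h s.
Proof.
pose H := isMultiplicative.Build P G pres_lift pres_liftM.
pose f : {multiplicative P -> G} := HB.pack pres_lift H.
by exists f => s; rewrite /f /= pres_lift_class /word_eval big_seq1.
Qed.

End PresentedTheory.

(** The form in which relations between generators are extracted. *)
Lemma pres_gen_relator (S : choiceType) (R : set (word S)) (r : word S) :
  R r -> word_eval (G := pres_group R) (pres_gen R) r = 1.
Proof.
move=> Rr; transitivity (pres_class R r : pres_group R).
  elim: r {Rr} => [|a r IH]; first by rewrite /word_eval big_nil.
  rewrite -cat1s pres_classM -IH pres_class_gen.
  by rewrite /word_eval big_cat big_seq1.
apply/pres_classP; rewrite -[r]cats0.
exact: (@pres_relator _ _ [::]).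
Qed.

Lemma pres_hom_eq (S : choiceType) (R : set (word S)) (G : groupType)
    (f k : {multiplicative pres_group R -> G}) :
  (forall s, f (pres_gen R s) = k (pres_gen R s)) -> f =1 k.
Proof.
move=> fk; elim/pres_ind => [|g s IH|g s IH]; first by rewrite !mult_hom1.
- by rewrite !gmulfM IH fk.
- by rewrite !gmulfM !mult_homV IH fk.
Qed.

(** * Free groups are torsion-free *)

Section FreeTorsion.
Variable S : choiceType.
Implicit Types (a b : S * bool) (u w s : word S).

Definition letter_inv a : S * bool := (a.1, ~~ a.2).

Lemma letter_invK : involutive letter_inv.
Proof. by case=> s b; rewrite /letter_inv /= negbK. Qed.

Definition no_cancel : rel (S * bool) := fun a b => b != letter_inv a.

(** A letter acts on reduced words by cancelling the top letter if it can, and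
    by being pushed on top otherwise.  The head of the list is the last letter
    of the word, so words are stored reversed. *)
Definition push s a : word S :=
  if s is b :: s' then if b == letter_inv a then s' else a :: s else [:: a].

Lemma push_reduced s a : sorted no_cancel s -> sorted no_cancel (push s a).
Proof.
case: s => [|b s] //= H; case: eqP => [_|/eqP ne].
  by move: H; case: s => //= c s /andP[].
rewrite /= H andbT /no_cancel; exact: ne.
Qed.

Lemma pushK s a :
  sorted no_cancel s -> push (push s a) (letter_inv a) = s.
Proof.
case: s => [|b s] //=; first by rewrite letter_invK eqxx.
case: eqP => [->|/eqP ne]; last by move=> _ /=; rewrite letter_invK eqxx.
case: s => [|c s] //= /andP[]; rewrite /no_cancel letter_invK => ne _.
by rewrite (negbTE ne).
Qed.

Lemma foldl_push_reduced s u :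
  sorted no_cancel s -> sorted no_cancel (foldl push s u).
Proof. by elim: u s => //= a u IH s /(push_reduced a)/IH. Qed.

(** van der Waerden's argument: the action of words on reduced words factors
    through the free group, because [pushK] is the only relation to check. *)
Lemma foldl_push_free u v s : pres_eq set0 u v ->
  sorted no_cancel s -> foldl push s u = foldl push s v.
Proof.
move=> uv; elim: uv s => {u v} //.
- by move=> u v _ IH s /IH.
- by move=> u v w _ IH1 _ IH2 s so; rewrite IH1 // IH2.
- move=> u v s b t so; rewrite !foldl_cat /=.
  by rewrite (@pushK _ (s, b)) //; exact: foldl_push_reduced.
Qed.

Lemma foldl_push_reducedE u s : sorted (fun a b => no_cancel b a) (rev u ++ s) ->
  foldl push s u = rev u ++ s.
Proof.
elim: u s => //= a u IH s; rewrite rev_cons cat_rcons => so.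
suff -> : push s a = a :: s by rewrite IH.
move: so => /cat_sorted2[_]; case: s => [|b s] //= /andP[].
rewrite /no_cancel => H _; case: eqP => // Eb.
by rewrite Eb letter_invK eqxx in H.
Qed.

(** A reduced word, acting on the empty word, produces its own reversal. *)
Lemma free_reduced_neq1 u : u != [::] ->
  sorted no_cancel u -> pres_class set0 u <> 1.
Proof.
move=> u0 so /pres_classP /(foldl_push_free (s := [::])) /(_ isT) /=.
rewrite foldl_push_reducedE cats0 ?rev_sorted //.
by move/(congr1 size); rewrite size_rev => /eqP; rewrite size_eq0 (negbTE u0).
Qed.

Lemma pres_class_rot (R : set (word S)) n u :
  exists g : pres_group R,
    pres_class R (rot n u) = (pres_class R u : pres_group R) ^ g.
Proof.
exists (pres_class R (take n u) : pres_group R).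
have Eu := pres_classM R (take n u) (drop n u); rewrite cat_take_drop in Eu.
by rewrite /rot pres_classM conjgE Eu -mulgA mulKg.
Qed.

Lemma cycle_flatten u n : cycle no_cancel u ->
  sorted no_cancel (flatten (nseq n.+1 u)).
Proof.
case: u => [_|a u]; first by elim: n.
rewrite /= rcons_path => /andP[pu la]; rewrite cat_path pu /=.
by elim: n (last a u) {1 2}la => //= n IH b ->; rewrite cat_path pu IH.
Qed.

Lemma not_sortedP u : ~~ sorted no_cancel u ->
  exists v a w, u = v ++ a :: letter_inv a :: w.
Proof.
elim: u => //= a [//|b u] IH /=; rewrite negb_and => /orP[|/IH].
  by rewrite negbK => /eqP->; exists [::], a, u.
by move=> [v [c [w ->]]]; exists (a :: v), c, w.
Qed.

(** A word which is not cyclically reduced has a rotation that starts with a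
    cancellation: rotations replace conjugation by single letters. *)
Lemma not_cycleP u : ~~ cycle no_cancel u ->
  exists n a v, rot n u = a :: letter_inv a :: v.
Proof.
have [so|/not_sortedP[v [a [w ->]]] _] := boolP (sorted no_cancel u); last first.
  by exists (size v), a, (w ++ v); rewrite rot_size_cat.
case: u so => //= a u so; rewrite rcons_path so /= negbK.
case/lastP: u so => [_|u b _]; rewrite ?last_rcons /=.
  by case: a => s [] /eqP[].
move=> /eqP ->; exists (size (letter_inv b :: u)), b, u.
by rewrite -rcons_cons -cats1 rot_size_cat.
Qed.

(** By induction on the length of a word: if it is cyclically reduced then so
    are its powers, which are then non-trivial; otherwise it is conjugate to a
    shorter word. *)
Lemma free_torsion_free (g : free_group S) n : g ^+ n.+1 = 1 -> g = 1.
Proof.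
suff H k u : (size u <= k)%N -> pres_class set0 u ^+ n.+1 = 1 ->
  pres_class set0 u = 1.
  by rewrite -[g]pres_reprK; exact: H.
elim: k u => [|k IH] u; first by rewrite leqn0 size_eq0 => /eqP->.
move=> uk un.
have [u0|/negbTE u0] := eqVneq u [::]; first by rewrite u0.
have [cy|/not_cycleP[m [a [v Ev]]]] := boolP (cycle no_cancel u).
  case: (@free_reduced_neq1 (flatten (nseq n.+1 u))).
  - by rewrite /= -size_eq0 size_cat addn_eq0 size_eq0 u0.
  - exact: cycle_flatten.
  - rewrite -un; elim: (n.+1) => //= j IHj.
    by rewrite pres_classM IHj expgS.
have [h' Eh] := pres_class_rot set0 m u.
have Ev' : pres_class set0 (rot m u) = pres_class set0 v.
  by rewrite Ev; apply/pres_classP; case: a {Ev} => s b;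
    exact: (pres_cancel set0 [::] v s b).
have v1 : pres_class set0 v = 1.
  apply: IH; last by rewrite -Ev' Eh -conjXg un conj1g.
  by move/(congr1 size): Ev uk; rewrite size_rot => -> /=; lia.
by move/eqP: Eh; rewrite Ev' v1 eq_sym conjg_eq1 => /eqP.
Qed.

End FreeTorsion.

(** * The Hecke group as a free product of cyclic groups *)

Section FreeProduct.
Variables G H : groupType.
Implicit Types (x y : G) (z t : H).

Definition free_product_inl x : free_product G H := pres_gen _ (inl x).
Definition free_product_inr z : free_product G H := pres_gen _ (inr z).

Lemma free_product_inlM : {morph free_product_inl : x y / x * y}.
Proof.
move=> x y; apply: esym; apply: divg1_eq.
rewrite -[RHS](@pres_gen_relator _ _ [:: (inl x, false); (inl y, false);
  (inl (x * y), true)]); last by left; exists x, y.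
by rewrite /word_eval !big_cons big_nil /= mulg1 mulgA.
Qed.

Lemma free_product_inrM : {morph free_product_inr : x y / x * y}.
Proof.
move=> x y; apply: esym; apply: divg1_eq.
rewrite -[RHS](@pres_gen_relator _ _ [:: (inr x, false); (inr y, false);
  (inr (x * y), true)]); last by right; exists x, y.
by rewrite /word_eval !big_cons big_nil /= mulg1 mulgA.
Qed.

HB.instance Definition _ :=
  isMultiplicative.Build _ _ free_product_inl free_product_inlM.
HB.instance Definition _ :=
  isMultiplicative.Build _ _ free_product_inr free_product_inrM.

Lemma free_product_lift (K : groupType) (f : {multiplicative G -> K})
    (k : {multiplicative H -> K}) :
  exists e : {multiplicative free_product G H -> K},
    (forall x, e (free_product_inl x) = f x) /\
    (forall z, e (free_product_inr z) = k z).
Proof.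
pose h (s : G + H) : K := match s with inl x => f x | inr z => k z end.
pose R : set (word (G + H)%type) :=
  [set w | exists x y : G,
     w = [:: (inl x, false); (inl y, false); (inl (x * y), true)]] `|`
  [set w | exists x y : H,
     w = [:: (inr x, false); (inr y, false); (inr (x * y), true)]].
have hR r : R r -> word_eval h r = 1.
  by case=> -[x [y ->]];
    rewrite /word_eval !big_cons big_nil /= gmulfM mulg1 mulgA mulgV.
have [e eP] := pres_lift_exists hR.
by exists e; split=> x; exact: eP.
Qed.

End FreeProduct.

Section HeckeGroup.
Variable p : nat.
Local Notation hp := (hecke p).

Definition heckeX : hp := pres_gen _ HX.
Definition heckeY : hp := pres_gen _ HY.

Lemma heckeX_exp : heckeX ^+ p = 1.
Proof.
rewrite -[RHS](@pres_gen_relator _ (hecke_relators p) (nseq p (HX, false)));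
  last by left; left.
by rewrite /word_eval big_nseq iter_mulg_1.
Qed.

Lemma heckeYY : heckeY * heckeY = 1.
Proof.
rewrite -[RHS](@pres_gen_relator _ (hecke_relators p)
  [:: (HY, false); (HY, false)]); last by left; right.
by rewrite /word_eval !big_cons big_nil /= mulg1.
Qed.

Lemma heckeZE : heckeZ p = heckeY * heckeX^-1.
Proof.
have XYZ : heckeX * heckeY * heckeZ p = 1.
  rewrite -[RHS](@pres_gen_relator _ (hecke_relators p)
    [:: (HX, false); (HY, false); (HZ, false)]); last by right.
  by rewrite /word_eval !big_cons big_nil /= mulg1 mulgA.
by rewrite -(mulg1_eq XYZ) invgM (mulg1_eq heckeYY).
Qed.

Lemma hecke_lift (G : groupType) (x y : G) : x ^+ p = 1 -> y * y = 1 ->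
  exists f : {multiplicative hp -> G}, f heckeX = x /\ f heckeY = y.
Proof.
move=> xp yy; pose h s := match s with HX => x | HY => y | HZ => y^-1 / x end.
have hR r : hecke_relators p r -> word_eval h r = 1.
  rewrite /word_eval; case=> [[]|] ->.
  - by rewrite big_nseq iter_mulg_1.
  - by rewrite !big_cons big_nil /= mulg1.
  - by rewrite !big_cons big_nil /= mulg1 mulVKg mulgV.
have [f fP] := pres_lift_exists hR.
by exists f; split; exact: fP.
Qed.

(** X and Y have finite order, so that their inverses are among their powers,
    and Z is a word in them. *)
Lemma hecke_ind (Q : hp -> Prop) : (0 < p)%N -> Q 1 ->
    (forall g, Q g -> Q (g * heckeX)) -> (forall g, Q g -> Q (g * heckeY)) ->
  forall g, Q g.
Proof.
move=> p0 Q1 QX QY.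
have QXn g n : Q g -> Q (g * heckeX ^+ n).
  by move=> Qg; elim: n => [|n IH]; rewrite ?mulg1 // expgSr mulgA; exact: QX.
have XV : heckeX^-1 = heckeX ^+ p.-1.
  by apply: mulg1_eq; rewrite -expgS prednK // heckeX_exp.
have YV : heckeY^-1 = heckeY by apply: mulg1_eq; exact: heckeYY.
apply: pres_ind => // g [] Qg.
- exact: QX.
- exact: QY.
- change (Q (g * heckeZ p)); rewrite heckeZE XV mulgA.
  exact/QXn/QY.
- change (Q (g * heckeX^-1)); rewrite XV; exact: QXn.
- change (Q (g * heckeY^-1)); rewrite YV; exact: QY.
- change (Q (g * (heckeZ p)^-1)); rewrite heckeZE invgM invgK YV mulgA.
  exact/QY/QX.
Qed.

Lemma hecke_hom_eq (G : groupType) (f k : {multiplicative hp -> G}) :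
  (0 < p)%N -> f heckeX = k heckeX -> f heckeY = k heckeY -> f =1 k.
Proof.
move=> p0 fkX fkY; apply: hecke_ind => // [|g IH|g IH].
- by rewrite !mult_hom1.
- by rewrite !gmulfM IH fkX.
- by rewrite !gmulfM IH fkY.
Qed.

End HeckeGroup.

Section CyclicGroup.
Variable n : nat.
Hypothesis n_gt1 : (1 < n)%N.
Local Notation one_n := ((1%R : 'Z_n) : cyclic_group n).

Lemma cyclic_group_expE k : one_n ^+ k = (k%:R)%R :> 'Z_n.
Proof.
elim: k => [//|k IH]; rewrite expgSr.
transitivity ((((one_n ^+ k)%g : 'Z_n) + (1 : 'Z_n))%R : 'Z_n); first by [].
by rewrite IH GRing.natr1.
Qed.

Lemma cyclic_group_exp_order : one_n ^+ n = 1.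
Proof. by rewrite cyclic_group_expE pchar_Zp. Qed.

Lemma cyclic_group_gen (i : cyclic_group n) : i = one_n ^+ nat_of_ord (i : 'Z_n).
Proof. by rewrite cyclic_group_expE natr_Zp. Qed.

Lemma cyclic_lift (G : groupType) (x : G) : x ^+ n = 1 ->
  exists f : {multiplicative cyclic_group n -> G}, f one_n = x.
Proof.
move=> xn.
have xmod m : x ^+ (m %% n) = x ^+ m.
  by rewrite {2}(divn_eq m n) expgnDr mulnC expgnA xn expg1n mul1g.
pose h (k : cyclic_group n) := x ^+ nat_of_ord (k : 'Z_n).
have hM : {morph h : i j / i * j}.
  move=> i j; rewrite /h -expgnDr -[RHS]xmod; congr (x ^+ _).
  by congr (_ %% _)%N; exact: Zp_cast.
pose H := isMultiplicative.Build _ _ h hM.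
pose f : {multiplicative cyclic_group n -> G} := HB.pack h H.
by exists f; rewrite /f /= /h /= modn_small.
Qed.

Lemma cyclic_hom_eq (G : groupType) (f k : {multiplicative cyclic_group n -> G}) :
  f one_n = k one_n -> f =1 k.
Proof. by move=> fk i; rewrite (cyclic_group_gen i) !mult_homX fk. Qed.

End CyclicGroup.

Lemma free_product_hom_eq (G H K : groupType)
    (f k : {multiplicative free_product G H -> K}) :
  f \o @free_product_inl G H =1 k \o @free_product_inl G H ->
  f \o @free_product_inr G H =1 k \o @free_product_inr G H -> f =1 k.
Proof.
by move=> fl fr; apply: pres_hom_eq => -[x|z]; [exact: fl|exact: fr].
Qed.

(** The universal properties of both sides give homomorphisms in both
    directions, which are inverse to each other on generators. *)
Lemma hecke_isomorphic p : (1 < p)%N ->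
  isomorphic (hecke p) (free_product (cyclic_group p) (cyclic_group 2)).
Proof.
move=> p_gt1.
set F := free_product _ _; pose x : cyclic_group p := (1%R : 'Z_p).
pose y : cyclic_group 2 := (1%R : 'Z_2).
have [||f [fX fY]] := @hecke_lift p F (free_product_inl _ x) (free_product_inr _ y).
- by rewrite -mult_homX cyclic_group_exp_order // mult_hom1.
- by rewrite -gmulfM -expg2 cyclic_group_exp_order // mult_hom1.
have [a aE] := cyclic_lift p_gt1 (heckeX_exp p).
have [b bE] := @cyclic_lift 2 isT (hecke p) (heckeY p) (heckeYY p).
have [k [kl kr]] := free_product_lift a b.
exists f; exists k.
- apply: (@hecke_hom_eq p _ (k \o f) idfun); first exact: ltnW.
  + by rewrite /= fX kl aE.
  + by rewrite /= fY kr bE.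
- apply: (@free_product_hom_eq _ _ _ (f \o k) idfun).
  + by apply: cyclic_hom_eq => //=; rewrite kl aE fX.
  + by apply: (@cyclic_hom_eq 2) => //=; rewrite kr bE fY.
Qed.

Lemma hecke_countable p (A : set (hecke p)) : countable A.
Proof.
pose letter (n : nat) := match n with 0%N => HX | 1%N => HY | _ => HZ end.
pose word_of (s : seq (nat * bool)) : word hecke_gen :=
  [seq (letter a.1, a.2) | a <- s].
have word_ofK u : exists s, word_of s = u.
  elim: u => [|[g b] u [s <-]]; first by exists [::].
  pose n := match g with HX => 0%N | HY => 1%N | HZ => 2%N end.
  by exists ((n, b) :: s); case: g @n.
apply: sub_countable (countableP [set: seq (nat * bool)]).
apply: card_le_trans (card_image_le
  (fun s => pres_class (hecke_relators p) (word_of s)) _).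
apply: subset_card_le => g _; have [s Es] := word_ofK (repr g).
by exists s => //; rewrite Es pres_reprK.
Qed.

(** * Actions of the Hecke group

    A permutation x of period p and an involution y make Gamma act on the
    right.  The inverse of x is written as the iterate [x'] of x, so that no
    separate inverse has to be supplied. *)

Section HeckeAction.
Variables (p : nat) (D : Type) (x y : D -> D).
Hypothesis p_gt0 : (0 < p)%N.
Hypothesis xp : forall d, iter p x d = d.
Hypothesis yK : involutive y.

Local Notation x' := (iter p.-1 x).

Lemma periodic_nextK : cancel x' x.
Proof. by move=> d; rewrite -iterS prednK. Qed.

Lemma periodic_prevK : cancel x x'.
Proof. by move=> d; rewrite -iterSr prednK. Qed.

Definition hecke_letter (d : D) (a : hecke_gen * bool) : D :=
  match a with
  | (HX, false) => x d
  | (HX, true) => x' d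
  | (HY, _) => y d
  | (HZ, false) => x' (y d)
  | (HZ, true) => y (x d)
  end.

Definition hecke_act (d : D) (g : hecke p) : D :=
  foldl hecke_letter d (repr g).

Lemma hecke_letter_iterX d n :
  foldl hecke_letter d (nseq n (HX, false)) = iter n x d.
Proof. by elim: n d => //= n IH d; rewrite IH -iterSr. Qed.

Lemma hecke_letter_pres d u v : pres_eq (hecke_relators p) u v ->
  foldl hecke_letter d u = foldl hecke_letter d v.
Proof.
move=> uv; elim: uv d => {u v} //.
- by move=> u v w _ IH1 _ IH2 d; rewrite IH1.
- move=> u v s b d; rewrite !foldl_cat /=; congr foldl.
  by case: s b => -[] /=; rewrite ?yK ?periodic_prevK ?periodic_nextK ?yK.
- move=> u v r Rr d; rewrite !foldl_cat; congr foldl.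
  move: (foldl _ d u) => {}d.
  case: Rr => [[]|] -> /=; last by rewrite yK periodic_prevK.
    by rewrite hecke_letter_iterX.
  exact: yK.
Qed.

Lemma hecke_act_class d u :
  hecke_act d (pres_class _ u) = foldl hecke_letter d u.
Proof. exact/hecke_letter_pres/pres_classP/pres_reprK. Qed.

Lemma hecke_act1 d : hecke_act d 1 = d.
Proof. exact: (hecke_act_class d [::]). Qed.

Lemma hecke_actM d g h : hecke_act d (g * h) = hecke_act (hecke_act d g) h.
Proof.
rewrite -[g]pres_reprK -[h]pres_reprK -[LHS]/(hecke_act d (pres_mul _ _)).
by rewrite pres_mul_class !hecke_act_class foldl_cat.
Qed.

Lemma hecke_actK g : cancel (hecke_act^~ g) (hecke_act^~ g^-1).
Proof. by move=> d /=; rewrite -hecke_actM mulgV hecke_act1. Qed.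

Lemma hecke_actKV g : cancel (hecke_act^~ g^-1) (hecke_act^~ g).
Proof. by move=> d /=; rewrite -hecke_actM mulVg hecke_act1. Qed.

Lemma hecke_actX d : hecke_act d (heckeX p) = x d.
Proof. exact: hecke_act_class. Qed.

Lemma hecke_actY d : hecke_act d (heckeY p) = y d.
Proof. exact: hecke_act_class. Qed.

Lemma hecke_actZ d : hecke_act d (heckeZ p) = x' (y d).
Proof. exact: hecke_act_class. Qed.

Lemma hecke_act_inj g : injective (hecke_act^~ g).
Proof. exact: can_inj (hecke_actK g). Qed.

End HeckeAction.

(** * Stabilisers: free generation and maximality *)

Lemma subgroupP (G : groupType) (K : set G) :
  subgroup K <-> K 1 /\ (forall g h, K g -> K h -> K (g * h^-1)).
Proof.
split=> -[K1 KM]; split.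
- by move: K1; rewrite inE.
- by move=> g h Kg Kh; have := KM g h; rewrite !inE; apply.
- by rewrite inE.
- by move=> g h; rewrite !inE; exact: KM.
Qed.

Section DartSystem.
Variables (p : nat) (D : eqType) (x y : D -> D) (base : D).
Hypothesis p_gt0 : (0 < p)%N.
Hypothesis xp : forall d, iter p x d = d.
Hypothesis yK : involutive y.
Hypothesis xx_neq : forall d, x (x d) <> d.

Local Notation x' := (iter p.-1 x).
Local Notation act := (hecke_act x y).

(** The darts fixed by Z.  Then d and [x d] are the two halves of a loop whose
    halves are consecutive around their vertex; only the first of them, in the
    order given by x, satisfies [loop]. *)
Definition loop : pred D := [pred d | x d == y d].

Let xK : cancel x x' := periodic_prevK p_gt0 xp.
Let x'K : cancel x' x := periodic_nextK p_gt0 xp.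

Lemma loop_y d : loop d -> x' (y d) = d.
Proof. by move=> /eqP<-. Qed.

Lemma loop_prev_y d : loop (x' d) -> y d = x' d.
Proof. by move=> /eqP; rewrite x'K => {1}->; rewrite yK. Qed.

Lemma loop_x d : loop d -> ~~ loop (x d).
Proof.
by move=> /eqP E; apply/negP => /eqP; rewrite {2}E yK => /xx_neq.
Qed.

(** The action on [D * G] in which traversing the loop at a multiplies the
    second component by [c a], or by its inverse in the other direction, and
    all other moves leave it unchanged. *)
Section Skew.
Variables (G : groupType) (c : D -> G).

Definition twist d : G :=
  if loop d then c d else if loop (x' d) then (c (x' d))^-1 else 1.

Definition skew_x (u : D * G) : D * G := (x u.1, u.2).
Definition skew_y (u : D * G) : D * G := (y u.1, u.2 * twist u.1).

Lemma skew_xp u : iter p skew_x u = u.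
Proof.
suff H n : iter n skew_x u = (iter n x u.1, u.2) by rewrite H xp; case: u {H}.
by elim: n => [|n /= ->] //; case: u.
Qed.

Lemma twist_y d : twist d * twist (y d) = 1.
Proof.
rewrite /twist; have [ld|nld] := boolP (loop d).
  move: (loop_x ld); rewrite (eqP ld) => /negbTE ->.
  by rewrite loop_y // ld mulgV.
have [ld'|nld'] := boolP (loop (x' d)).
  by rewrite loop_prev_y // ld' mulVg.
case: ifP => [ly|_].
  have E : x' d = y d by move/eqP: ly; rewrite yK => {1}<-.
  by case/negP: nld'; rewrite E.
case: ifP => [ly|_]; last by rewrite mulg1.
by have := loop_prev_y ly; rewrite yK => E; rewrite -E (negbTE nld) in ly.
Qed.

Lemma skew_yK : involutive skew_y.
Proof. by case=> d w; rewrite /skew_y /= yK -mulgA twist_y mulg1. Qed.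

Local Notation sact := (hecke_act skew_x skew_y).
Let sactM := @hecke_actM p (D * G) skew_x skew_y p_gt0 skew_xp skew_yK.
Let sact1 := @hecke_act1 p (D * G) skew_x skew_y p_gt0 skew_xp skew_yK.
Let sactX := @hecke_actX p (D * G) skew_x skew_y p_gt0 skew_xp skew_yK.
Let sactY := @hecke_actY p (D * G) skew_x skew_y p_gt0 skew_xp skew_yK.

Lemma skew_fst u (g : hecke p) : (sact u g).1 = act u.1 g.
Proof.
move: g; apply: (hecke_ind p_gt0) => [|g IH|g IH].
- by rewrite sact1 hecke_act1.
- by rewrite sactM sactX hecke_actM // hecke_actX // -IH.
- by rewrite sactM sactY hecke_actM // hecke_actY // -IH.
Qed.

Lemma skew_heckeZ a w : loop a -> sact (a, w) (heckeZ p) = (a, w * c a).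
Proof.
move=> la; rewrite heckeZE sactM.
apply: (hecke_act_inj p_gt0 skew_xp skew_yK (g := heckeX p)).
rewrite /= (hecke_actKV p_gt0 skew_xp skew_yK) sactY sactX.
by rewrite /skew_y /skew_x /= /twist la (eqP la).
Qed.

End Skew.

(** The subgroups containing a point stabiliser correspond to the invariant
    equivalence relations e; the only ones here are equality and the full
    relation. *)
Section Primitive.
Variable e : D -> D -> Prop.
Hypothesis e_refl : forall d, e d d.
Hypothesis e_sym : forall d d', e d d' -> e d' d.
Hypothesis e_trans : forall d' d d'', e d d' -> e d' d'' -> e d d''.
Hypothesis e_x : forall d d', e d d' -> e (x d) (x d').
Hypothesis e_y : forall d d', e d d' -> e (y d) (y d').
Hypothesis transitive : forall d d', exists g : hecke p, act d g = d'.

(** The action of X Y, the inverse of Z: one step along a face. *)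
Definition face_step (d : D) : D := y (x d).
Local Notation W := face_step.

Hypothesis has_loop : exists a, loop a.
Hypothesis one_face : forall d d', ~~ loop d -> ~~ loop d' ->
  exists m n, iter m W d = iter n W d'.
Hypothesis long_run : forall r, exists2 d, ~~ loop d &
  forall i, (i < r)%N -> ~~ loop (x' (iter i W d)).

Lemma face_step_loop a : loop a -> W a = a.
Proof. by move=> /eqP la; rewrite /W la yK. Qed.

Lemma face_step_inj : injective W.
Proof. exact: inj_comp (can_inj yK) (can_inj xK). Qed.

Lemma e_x' d d' : e d d' -> e (x' d) (x' d').
Proof. by move=> edd; elim: p.-1 => //= n; exact: e_x. Qed.

Lemma e_act (g : hecke p) d d' : e d d' -> e (act d g) (act d' g).
Proof.
move=> edd; move: g; apply: (hecke_ind p_gt0) => [|g IH|g IH].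
- by rewrite !hecke_act1.
- by rewrite !hecke_actM // !hecke_actX //; exact: e_x.
- by rewrite !hecke_actM // !hecke_actY //; exact: e_y.
Qed.

Lemma e_iter n d d' : e d d' <-> e (iter n W d) (iter n W d').
Proof.
elim: n => //= n ->; split=> [/e_x/e_y//|/e_y].
by rewrite /W !yK => /e_x'; rewrite !xK.
Qed.

Lemma iter_face_step_loop n a : loop a -> iter n W a = a.
Proof. by move=> la; elim: n => //= n ->; exact: face_step_loop. Qed.

(** Since a is fixed by [face_step], its class contains the face of o, hence all
    darts off the loops; in particular it contains [x a], so it is stable under
    x, and it contains the remaining darts because they are preimages under x
    of darts off the loops. *)
Lemma mixed_class_full a o : loop a -> ~~ loop o -> e a o -> forall d, e a d.
Proof.
move=> la no eao.
have eaO o' : ~~ loop o' -> e a o'.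
  move=> no'; have [m [n E]] := one_face no no'.
  apply/(e_iter n); rewrite -E iter_face_step_loop //.
  by rewrite -(iter_face_step_loop m la); exact: (e_iter m a o).1 eao.
have eax d n : e a d -> e a (iter n x d).
  move=> ead; elim: n => //= n /e_x; apply: e_trans.
  exact: eaO (loop_x la).
move=> d; have [ld|/eaO//] := boolP (loop d).
by rewrite -[d]xK; apply: eax; exact: eaO (loop_x ld).
Qed.

(** If the class of d is invariant under r steps, it meets every run of r
    consecutive darts of the face, in particular a run that no loop ends in. *)
Lemma periodic_class (d : D) r : (0 < r)%N -> ~~ loop d ->
  e (iter r W d) d -> exists2 b, ~~ loop (x' b) & e b d.
Proof.
move=> r0 nd erd; have [d0 n0 long] := long_run r.
have [m [n E]] := one_face n0 nd.
have eC b : e b d <-> e (iter r W b) d.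
  split=> [/(e_iter r)|] H; first exact: e_trans erd.
  by apply/(e_iter r); apply: e_trans H (e_sym erd).
have eCn k b : e b d <-> e (iter (r * k) W b) d.
  elim: k b => [|k IH] b; first by rewrite muln0.
  by rewrite mulnS iterD -eC.
(* the shift k makes n + k a multiple of r *)
pose k := (r * n - n)%N.
have Ek : iter (m + k) W d0 = iter (r * n) W d.
  by rewrite addnC iterD E -iterD subnK // leq_pmull.
exists (iter ((m + k) %% r) W d0); first exact/long/ltn_pmod.
apply/(eCn ((m + k) %/ r)%N); rewrite -iterD mulnC -divn_eq Ek.
exact: (eCn n d).1 (e_refl d).
Qed.

(** By [mixed_class_full] it is enough to exclude a relation whose classes never
    mix loops with other darts.  Transitivity then provides equivalent loops a
    and b, and [periodic_class] applies to [x a] or to [x b], whose class is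
    made of darts [x f] with f equivalent to a, hence a loop. *)
Lemma invariant_relation_full : (exists d d', d <> d' /\ e d d') ->
  forall d d', e d d'.
Proof.
move=> [d1 [d2 [ne12 e12]]].
suff [a ea] : exists a, forall d, e a d.
  by move=> d d'; apply: e_trans (ea d'); exact: e_sym.
apply: contrapT => nofull.
have unmixed a b : loop a -> e a b -> loop b.
  move=> la eab; apply: contrapT => /negP nb; apply: nofull.
  by exists a; exact: mixed_class_full la nb eab.
have [a la] := has_loop; have [g Eg] := transitive d1 a.
set b := act d2 g; have ne : a <> b.
  by rewrite -Eg => /(hecke_act_inj p_gt0 xp yK).
have eab : e a b by rewrite -Eg; exact: e_act.
have lb := unmixed _ _ la eab.
(* the class of x c would be periodic, yet it consists of darts x f, f a loop *)
have step c d r : loop c -> e c d -> (0 < r)%N ->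
    iter r W (x c) = x d -> False.
  move=> lc ecd r0 E; have [|f] := periodic_class (d := x c) r0 (loop_x lc).
    by rewrite E; apply: e_sym; exact: e_x.
  move=> /negP nf /e_sym/e_x'; rewrite xK => ecf.
  by case: nf; exact: unmixed lc ecf.
have [m [n E]] := one_face (loop_x la) (loop_x lb).
have Winj k : injective (iter k W).
  by elim: k => //= k IH d d' /face_step_inj/IH.
have [mn|nm|mn] := ltngtP m n.
- apply: (step b a (n - m)%N) => //; rewrite ?subn_gt0 //; first exact: e_sym.
  by apply: (Winj m); rewrite E -iterD subnKC // ltnW.
- apply: (step a b (m - n)%N) => //; rewrite ?subn_gt0 //.
  by apply: (Winj n); rewrite -E -iterD subnKC // ltnW.
- by rewrite mn in E; move/Winj: E => /(can_inj xK).
Qed.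

End Primitive.

(** The next hypotheses say that the edges other than loops form a spanning
    tree: every dart can be reached by turning and by crossing such edges, and
    [path] assigns to each dart the element of Gamma that leads to it from the
    base dart along the tree. *)
Section SpanningTree.
Variable path : D -> hecke p.
Hypothesis path_base : path base = 1.
Hypothesis path_x : forall d, path (x d) = path d * heckeX p.
Hypothesis path_y : forall d, ~~ loop d -> ~~ loop (x' d) ->
  path (y d) = path d * heckeY p.
Hypothesis tree_ind : forall Q : D -> Prop, Q base ->
    (forall d, Q d -> Q (x d)) ->
    (forall d, ~~ loop d -> ~~ loop (x' d) -> Q d -> Q (y d)) ->
  forall d, Q d.

Lemma skew_path (G : groupType) (c : D -> G) w d :
  hecke_act (skew_x (G := G)) (skew_y c) (base, w) (path d) = (d, w).
Proof.
have xpG := @skew_xp G; have yKG := skew_yK c.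
elim/tree_ind: d => [|d IH|d nl nl' IH].
- by rewrite path_base hecke_act1.
- by rewrite path_x hecke_actM // IH hecke_actX.
- rewrite path_y // hecke_actM // IH hecke_actY //.
  by rewrite /skew_y /twist /= (negbTE nl) (negbTE nl') mulg1.
Qed.

Lemma act_path d : act base (path d) = d.
Proof.
have := skew_path (fun=> (1 : 'I_1)) 1 d.
by move/(congr1 fst); rewrite skew_fst.
Qed.

Definition loop_elt (a : D) : hecke p := heckeZ p ^ (path a)^-1.

Lemma loop_eltE a : loop_elt a = path a * heckeZ p * (path a)^-1.
Proof. by rewrite /loop_elt conjgE invgK mulgA. Qed.

Lemma skew_loop_elt (G : groupType) (c : D -> G) w a : loop a ->
  hecke_act (skew_x (G := G)) (skew_y c) (base, w) (loop_elt a) =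
  (base, w * c a).
Proof.
move=> la; have xpG := @skew_xp G; have yKG := skew_yK c.
rewrite loop_eltE !hecke_actM // skew_path skew_heckeZ //.
by rewrite -(skew_path c _ a) hecke_actK.
Qed.

(** Counting modulo 2 the passages through a separates a from other loops. *)
Lemma loop_elt_inj a b : loop a -> loop b -> loop_elt a = loop_elt b -> a = b.
Proof.
move=> la lb E; pose c d : 'I_2 := if d == a then 1%R else 0%R.
have := skew_loop_elt c 1 lb; rewrite -E skew_loop_elt // => /(congr1 snd) /=.
rewrite /c eqxx !mul1g; by case: eqP.
Qed.

Definition stabiliser : set (hecke p) := [set g | act base g = base].

Definition loop_elts : set (hecke p) := [set loop_elt a | a in [set` loop]].

Lemma stabiliser_subgroup : subgroup stabiliser.
Proof.
apply/subgroupP; split; first exact: hecke_act1.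
move=> g h; rewrite /stabiliser /= => Eg Eh.
by rewrite hecke_actM // Eg -{1}Eh hecke_actK.
Qed.

(** The Schreier argument: following a word letter by letter, each passage
    through a loop contributes a factor from [loop_elts] or its inverse, and
    every other letter is absorbed by [path]. *)
Lemma loop_elts_generate (g : hecke p)
    (f : {multiplicative free_group loop_elts -> hecke p}) :
  (forall t : loop_elts, f (pres_gen set0 t) = set_val t) ->
  exists w, g = f w * path (act base g).
Proof.
move=> fP.
have fE a : loop a -> exists w, f w = loop_elt a.
  move=> la; have Ta : loop_elts (loop_elt a) by exists a.
  by exists (pres_gen set0 (SigSub (mem_set Ta))); rewrite fP.
move: g; apply: (hecke_ind p_gt0) => [|g [w Ew]|g [w Ew]].
- by exists 1; rewrite mult_hom1 hecke_act1 // path_base mulg1.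
- exists w; rewrite hecke_actM // hecke_actX // path_x {1}Ew.
  by rewrite -mulgA.
- rewrite hecke_actM // hecke_actY //; set d := act base g in Ew *.
  have [ld|nl] := boolP (loop d).
    have [v Ev] := fE _ ld; exists (w * v).
    rewrite gmulfM Ev {1}Ew -(eqP ld) path_x loop_eltE heckeZE.
    by rewrite !mulgA !mulgVK.
  have [ld|nl'] := boolP (loop (x' d)).
    have [v Ev] := fE _ ld; exists (w * v^-1).
    rewrite gmulfM mult_homV Ev {1}Ew loop_prev_y // /loop_elt heckeZE.
    rewrite -{1}(x'K d) path_x conjgE !invgM !invgK.
    by rewrite (mulg1_eq (heckeYY p)) !mulgA !mulgVK.
  by exists w; rewrite path_y // {1}Ew mulgA.
Qed.

(** With [c] sending each loop to the corresponding free generator, the second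
    component of the skew action is a left inverse of the homomorphism from the
    free group. *)
Lemma stabiliser_free : freely_generated stabiliser loop_elts.
Proof.
have no_rel (r : word loop_elts) : set0 r -> word_eval set_val r = 1 :> hecke p.
  by [].
have [f fP] := pres_lift_exists no_rel.
pose c a : free_group loop_elts := if pselect (loop_elts (loop_elt a)) is left h
  then pres_gen set0 (SigSub (mem_set h)) else 1.
have fK w : hecke_act (skew_x (G := _)) (skew_y c) (base, 1) (f w) = (base, w).
  have xpG := @skew_xp (free_group loop_elts); have yKG := skew_yK c.
  have fgen v t : hecke_act (skew_x (G := _)) (skew_y c) (base, v)
      (f (pres_gen set0 t)) = (base, v * pres_gen set0 t).
    have [a la Ea] := set_mem (valP t).
    rewrite fP -[set_val t]Ea skew_loop_elt //; congr (_, _ * _); rewrite /c.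
    case: pselect => [h|[]]; last by exists a.
    by congr pres_gen; apply: val_inj.
  move: w; apply: pres_ind => [|w t IH|w t IH].
  - by rewrite mult_hom1 hecke_act1.
  - by rewrite gmulfM hecke_actM // IH fgen.
  - rewrite gmulfM mult_homV hecke_actM // IH.
    apply: (hecke_act_inj p_gt0 xpG yKG (g := f (pres_gen set0 t))).
    by rewrite hecke_actKV // fgen mulgVK.
exists f; split; first exact: fP.
- by move=> v w E; have := fK v; rewrite E fK => -[].
- apply/seteqP; split=> [g [w _ <-]|g gM].
    by have /(congr1 fst) := fK w; rewrite skew_fst.
  have [w ->] := loop_elts_generate g fP.
  by rewrite gM path_base mulg1; exists w.
Qed.

Lemma stabiliser_torsion_free : torsion_free stabiliser.
Proof.
have [f [_ f_inj fM]] := stabiliser_free.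
move=> g; rewrite -fM => -[w _ <-] n; rewrite -mult_homX -(mult_hom1 f).
by move=> /f_inj/free_torsion_free->.
Qed.

(** A subgroup K containing the stabiliser is recovered from the invariant
    relation in which d and d' are equivalent when [path d] and [path d'] lie in
    the same right coset of K. *)
Lemma stabiliser_maximal :
    (exists a, loop a) ->
    (forall d d', ~~ loop d -> ~~ loop d' ->
       exists m n, iter m face_step d = iter n face_step d') ->
    (forall r, exists2 d, ~~ loop d &
       forall i, (i < r)%N -> ~~ loop (x' (iter i face_step d))) ->
  maximal_subgroup stabiliser.
Proof.
move=> has_loop one_face long_run; split; first exact: stabiliser_subgroup.
  move=> MT; have : stabiliser (heckeX p) by rewrite MT.
  by rewrite /stabiliser /= hecke_actX // => E; case: (@xx_neq base); rewrite !E.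
move=> K sK MK; have [K1 KM] := (subgroupP K).1 sK.
have KV g : K g -> K g^-1 by move=> Kg; rewrite -[g^-1]mul1g; exact: KM.
have KMM g h : K g -> K h -> K (g * h).
  by move=> Kg Kh; rewrite -[h]invgK; apply: KM => //; exact: KV.
have KP g d : act base g = d -> K (path d * g^-1).
  by move=> <-; apply: MK; rewrite /stabiliser /= hecke_actM // act_path hecke_actK.
pose e d d' := K (path d * (path d')^-1).
have eP g h : K (g * h^-1) <-> e (act base g) (act base h).
  have Kg := KP g _ erefl; have Kh := KP h _ erefl; rewrite /e; split=> H.
    have := KMM _ _ (KMM _ _ Kg H) (KV _ Kh).
    by rewrite invgM invgK !mulgA !mulgVK.
  have := KMM _ _ (KMM _ _ (KV _ Kg) H) Kh.
  by rewrite invgM invgK !mulgA !mulgVK.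
have [ne|trivial_e] := pselect (exists d d', d <> d' /\ e d d'); [right|left].
  have full : forall d d', e d d'.
    apply: invariant_relation_full => //.
    - by move=> d; rewrite /e mulgV.
    - by move=> d d' /KV; rewrite invgM invgK.
    - move=> d' d d'' H1 H2; have := KMM _ _ H1 H2.
      by rewrite mulgA mulgVK.
    - by move=> d d'; rewrite /e !path_x invgM mulgA mulgK.
    - move=> d d' H; rewrite -(act_path d) -(act_path d').
      rewrite -!(hecke_actY p_gt0 xp yK) -!(hecke_actM p_gt0 xp yK).
      by apply: (eP _ _).1; rewrite invgM mulgA mulgK.
    - move=> d d'; exists ((path d)^-1 * path d').
      by rewrite hecke_actM // -{1}(act_path d) hecke_actK // act_path.
  apply/seteqP; split=> // g _; rewrite -[g]mulg1 -invg1; apply: (eP _ _).2;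
    exact: full.
apply/seteqP; split=> // g Kg; rewrite /stabiliser /=.
apply: contrapT => ne; apply: trivial_e; exists (act base g), base; split=> //.
rewrite -{2}(hecke_act1 p_gt0 xp yK base); apply: (eP _ _).1.
by rewrite invg1 mulg1.
Qed.

Lemma loop_elts_parabolic : (exists d, ~~ loop d) ->
  loop_elts `<=` hecke_parabolic (p := p).
Proof.
move=> [d nd] g [a la <-]; exists (heckeZ p), (path a)^-1; split=> //.
  by exists 1%N; left.
move=> Z1; have := hecke_actZ p_gt0 xp yK d; rewrite Z1 hecke_act1 // => E.
by move/negP: nd; apply; apply/eqP; rewrite {1}E x'K.
Qed.

End SpanningTree.

End DartSystem.

(** * Caterpillar trees

    The triple (b, n, i) is the dart number i at a vertex, in the cyclic order
    given by X: the n-th spine vertex if b is true, the n-th leaf vertex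
    otherwise.

    - At the spine vertex n, dart 0 points down, to the spine vertex n - 1 or,
      if n = 0, to the leaf vertex 0.  Darts 1 and 2 lead to the spine vertex
      n + 1 and to the leaf vertex n + 1, in the order prescribed by [eps n].
    - At a leaf vertex, dart 0 leads to the spine.
    - The remaining darts are joined in pairs (i, i + 1), i odd, into loops. *)

Section Caterpillar.
Variables (p : nat) (eps : nat -> bool).
Hypothesis p_ge3 : (3 <= p)%N.
Hypothesis p_odd : odd p.

Let p_gt0 : (0 < p)%N. Proof. exact: leq_trans p_ge3. Qed.

Definition dart : Type := {t : bool * nat * nat | (t.2 < p)%N}.
HB.instance Definition _ := SubChoice.on dart.

Definition up n : nat := if eps n then 1%N else 2%N.
Definition side n : nat := if eps n then 2%N else 1%N.

Definition turn (t : bool * nat * nat) : bool * nat * nat :=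
  let: (b, n, i) := t in (b, n, if i.+1 == p then 0%N else i.+1).

Definition flip (t : bool * nat * nat) : bool * nat * nat :=
  let: (b, n, i) := t in
  if i == 0%N then
    if n is m.+1 then (true, m, if b then up m else side m) else (~~ b, 0%N, 0%N)
  else if b && (i <= 2)%N then (i == up n, n.+1, 0%N)
  else (b, n, if odd i then i.+1 else i.-1).

Lemma turn_lt t : (t.2 < p)%N -> ((turn t).2 < p)%N.
Proof. by case: t => [[b n] i] /= ip; case: ifP => /eqP; lia. Qed.

Lemma flip_lt t : (t.2 < p)%N -> ((flip t).2 < p)%N.
Proof.
case: t => [[b n] i] /= ip; case: eqP => i0.
  case: n => [|n] //=; rewrite /up /side; case: b; case: (eps n); lia.
by case: ifP => //= _; case: ifP; lia.
Qed.

Lemma flipK t : (t.2 < p)%N -> flip (flip t) = t.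
Proof.
case: t => [[b n] i] /= ip; case: eqP => [->|i0].
  by case: n => [|n]; case: b => //=; rewrite /up /side; case: (eps n).
case: ifP => [/andP[-> i2] /=|bi].
  rewrite /up /side; case: (eps n);
    by move: i2 i0; case: i {ip} => [|[|[|i]]].
case: (boolP (odd i)) => oi /=.
  by rewrite oi /= ifF //; apply: contraFF bi => /andP[-> ] /=; lia.
rewrite ifF; last by lia.
rewrite ifF; last by apply: contraFF bi => /andP[->] /=; lia.
by rewrite ifT; [congr (_, _, _)|]; lia.
Qed.

Definition dart_x (d : dart) : dart := Sub (turn (val d)) (turn_lt (valP d)).
Definition dart_y (d : dart) : dart := Sub (flip (val d)) (flip_lt (valP d)).
Definition dart_base : dart := Sub (true, 0%N, 0%N) p_gt0.
Definition mk (t : bool * nat * nat) : dart := insubd dart_base t.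

Lemma val_mk t : (t.2 < p)%N -> val (mk t) = t.
Proof. by move=> tp; rewrite /mk val_insubd tp. Qed.

Lemma mk_val d : mk (val d) = d.
Proof. exact: valKd. Qed.

Lemma mk_x t : (t.2 < p)%N -> dart_x (mk t) = mk (turn t).
Proof. by move=> tp; apply: val_inj; rewrite /= !val_mk ?turn_lt. Qed.

Lemma mk_y t : (t.2 < p)%N -> dart_y (mk t) = mk (flip t).
Proof. by move=> tp; apply: val_inj; rewrite /= !val_mk ?flip_lt. Qed.

Lemma mk_eq t u : (t.2 < p)%N -> (u.2 < p)%N -> (mk t == mk u) = (t == u).
Proof. by move=> tp ulp; rewrite -val_eqE /= !val_mk. Qed.

Lemma dart_elim (Q : dart -> Prop) :
  (forall b n i, (i < p)%N -> Q (mk (b, n, i))) -> forall d, Q d.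
Proof. by move=> H d; rewrite -(mk_val d); case: d => [[[b n] i] ip]; exact: H. Qed.

Lemma dart_yK : involutive dart_y.
Proof. by move=> d; apply: val_inj; exact: flipK (valP d). Qed.

Lemma dart_x_iter b n i k : (i + k < p)%N ->
  iter k dart_x (mk (b, n, i)) = mk (b, n, i + k)%N.
Proof.
elim: k => [|k IH] ikp; first by rewrite addn0.
rewrite iterS IH; last lia.
rewrite mk_x /=; last lia.
by rewrite addnS ifF //; apply/eqP; lia.
Qed.

Lemma dart_xp d : iter p dart_x d = d.
Proof.
elim/dart_elim: d => b n i ip.
have -> : p = (i + (p - i.+1).+1)%N by lia.
rewrite iterD iterS dart_x_iter; last lia.
rewrite mk_x /=; last lia.
rewrite ifT; last by apply/eqP; lia.
by rewrite dart_x_iter.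
Qed.

Local Notation loop := (loop dart_x dart_y).
Local Notation x' := (iter p.-1 dart_x).

Lemma loop_mk b n i : (i < p)%N ->
  loop (mk (b, n, i)) = odd i && ~~ (b && (i <= 2)%N).
Proof.
move=> ip; rewrite /loop inE mk_x // mk_y // mk_eq ?turn_lt ?flip_lt //=.
case: (eqVneq i 0%N) => [->|i0] /=.
  by case: n => [|n]; apply/eqP; case: b => -[] //; lia.
have [/andP[-> i2]|bi] := boolP (b && (i <= 2)%N).
  by rewrite andbF; apply/eqP => -[]; lia.
rewrite andbT; case: (boolP (odd i)) => oi.
  by rewrite ifF ?eqxx //; apply/eqP; lia.
by apply/eqP => -[]; case: eqP; lia.
Qed.

Lemma dart_prev b n i : (i.+1 < p)%N -> x' (mk (b, n, i.+1)) = mk (b, n, i).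
Proof.
move=> ip; rewrite -[RHS](periodic_prevK p_gt0 dart_xp) mk_x /=; last lia.
by rewrite ifF //; apply/eqP; lia.
Qed.

Lemma dart_prev0 b n : x' (mk (b, n, 0%N)) = mk (b, n, p.-1).
Proof.
rewrite -[RHS](periodic_prevK p_gt0 dart_xp) mk_x /=; last lia.
by rewrite prednK // eqxx.
Qed.

Lemma dart_xx_neq d : dart_x (dart_x d) <> d.
Proof.
elim/dart_elim: d => b n i ip; rewrite mk_x // mk_x ?turn_lt //.
apply/eqP; rewrite mk_eq ?turn_lt //=.
by apply/eqP => -[]; do 2!case: eqP; lia.
Qed.

Lemma up_lt n : (up n < p)%N.
Proof. by rewrite /up; case: ifP; lia. Qed.

Lemma side_lt n : (side n < p)%N.
Proof. by rewrite /side; case: ifP; lia. Qed.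

Lemma nonloop_down b n : ~~ loop (mk (b, n, 0%N)).
Proof. by rewrite loop_mk. Qed.

Lemma nonloop_last b n : ~~ loop (x' (mk (b, n, 0%N))).
Proof. by rewrite dart_prev0 loop_mk ?prednK // negb_and; case: b; lia. Qed.

Lemma nonloop_spine n i : (i <= 2)%N -> ~~ loop (mk (true, n, i)).
Proof. by move=> i2; rewrite loop_mk ?i2 ?andbF //; lia. Qed.

Lemma nonloop_spine_prev n i : (i <= 2)%N -> ~~ loop (x' (mk (true, n, i))).
Proof.
case: i => [|i] i2; first exact: nonloop_last.
by rewrite dart_prev ?nonloop_spine //; lia.
Qed.

Lemma up_le2 n : (0 < up n <= 2)%N. Proof. by rewrite /up; case: ifP. Qed.
Lemma side_le2 n : (0 < side n <= 2)%N. Proof. by rewrite /side; case: ifP. Qed.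

Lemma flip_spine n i : (0 < i <= 2)%N ->
  flip (true, n, i) = (i == up n, n.+1, 0%N).
Proof. by move=> /andP[i0 i2]; rewrite /= i2 gtn_eqF. Qed.

Lemma side_neq_up n : (side n == up n) = false.
Proof. by rewrite /side /up; case: ifP. Qed.

Lemma spine_dart n i : (0 < i <= 2)%N -> i = up n \/ i = side n.
Proof.
rewrite /up /side; case: ifP; case: i => [|[|[|i]]] // _ _;
  by [left|right].
Qed.

Lemma flip_up n : dart_y (mk (true, n, up n)) = mk (true, n.+1, 0%N).
Proof. by rewrite mk_y ?up_lt // flip_spine ?up_le2 // eqxx. Qed.

Lemma flip_side n : dart_y (mk (true, n, side n)) = mk (false, n.+1, 0%N).
Proof. by rewrite mk_y ?side_lt // flip_spine ?side_le2 // side_neq_up. Qed.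

(** Climb the spine, step aside to the leaves, and turn around each vertex. *)
Lemma caterpillar_tree_ind (Q : dart -> Prop) : Q dart_base ->
    (forall d, Q d -> Q (dart_x d)) ->
    (forall d, ~~ loop d -> ~~ loop (x' d) -> Q d -> Q (dart_y d)) ->
  forall d, Q d.
Proof.
move=> Q0 Qx Qy.
have Qn b n i : (i < p)%N -> Q (mk (b, n, 0%N)) -> Q (mk (b, n, i)).
  by move=> ip Qb; rewrite -[i]add0n -dart_x_iter //; elim: i {ip} => //= i; exact: Qx.
have Qs n : Q (mk (true, n, 0%N)).
  elim: n => [|n IH]; first by rewrite -[mk _]/(mk (val dart_base)) mk_val.
  have /andP[_ u2] := up_le2 n.
  rewrite -flip_up; apply: Qy; rewrite ?nonloop_spine ?nonloop_spine_prev //.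
  exact/Qn/IH/up_lt.
have Ql n : Q (mk (false, n, 0%N)).
  case: n => [|n].
    have -> : mk (false, 0%N, 0%N) = dart_y (mk (true, 0%N, 0%N)) by rewrite mk_y.
    by apply: Qy; rewrite ?nonloop_down ?nonloop_last.
  have /andP[_ s2] := side_le2 n.
  rewrite -flip_side; apply: Qy; rewrite ?nonloop_spine ?nonloop_spine_prev //.
  exact/Qn/Qs/side_lt.
by apply: dart_elim => b n i ip; apply: Qn => //; case: b.
Qed.

Local Notation X := (heckeX p).
Local Notation Y := (heckeY p).

Fixpoint spine_path n : hecke p :=
  if n is m.+1 then spine_path m * X ^+ up m * Y else 1.

Definition dart_path (d : dart) : hecke p :=
  let: (b, n, i) := val d in
  (if b then spine_path n else
   if n is m.+1 then spine_path m * X ^+ side m * Y else Y) * X ^+ i.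

Lemma dart_path_base : dart_path dart_base = 1.
Proof. by rewrite /dart_path /= mulg1. Qed.

Lemma dart_path_x d : dart_path (dart_x d) = dart_path d * X.
Proof.
rewrite /dart_path; case: d => [[[b n] i] /= ip].
rewrite -mulgA -expgSr; case: eqP => [->|//].
by rewrite heckeX_exp.
Qed.

Lemma dart_path_y d : ~~ loop d -> ~~ loop (x' d) ->
  dart_path (dart_y d) = dart_path d * Y.
Proof.
elim/dart_elim: d => b n i ip; rewrite loop_mk // mk_y // => nl nl'.
rewrite /dart_path !val_mk ?flip_lt //=.
have YK g : g * Y * Y = g by rewrite -mulgA heckeYY mulg1.
case: (eqVneq i 0%N) nl nl' ip => [-> _ _ _|i0 nl nl' ip].
  case: n => [|n]; case: b => //=; rewrite ?mulg1 ?YK ?mul1g ?heckeYY //.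
have [/andP[-> i2]|bi] := boolP (b && (i <= 2)%N).
  have [->|->] : i = up n \/ i = side n by apply: spine_dart; rewrite lt0n i0.
  - by rewrite eqxx mulg1.
  - by rewrite side_neq_up mulg1.
move: nl nl'; rewrite bi andbT; case: i i0 ip bi => // i _ ip bi oi.
rewrite dart_prev // loop_mk ?(ltnW ip) //.
by move: bi oi; case: b; lia.
Qed.

Local Notation W := (face_step dart_x dart_y).

(** Lying on a common face.  Comparing two forward iterates makes transitivity
    a computation, with no negative powers. *)
Definition same_face (d d' : dart) := exists m n, iter m W d = iter n W d'.

Lemma same_face_refl d : same_face d d.
Proof. by exists 0%N, 0%N. Qed.

Lemma same_face_sym d d' : same_face d d' -> same_face d' d.
Proof. by case=> m [n E]; exists n, m. Qed.

Lemma same_face_trans d' d d'' :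
  same_face d d' -> same_face d' d'' -> same_face d d''.
Proof.
case=> m [n E] [m' [n' E']]; exists (m' + m)%N, (n + n')%N.
by rewrite iterD E -iterD addnC iterD E' -iterD.
Qed.

Lemma same_face_step d d' : W d = d' -> same_face d d'.
Proof. by move=> <-; exists 1%N, 0%N. Qed.

Lemma face_step_succ b n i : (i.+1 < p)%N ->
  W (mk (b, n, i)) = dart_y (mk (b, n, i.+1)).
Proof.
by move=> ip; rewrite /face_step mk_x /= 1?ltnW // ifF //; apply/eqP; lia.
Qed.

Lemma face_step_last b n : W (mk (b, n, p.-1)) = dart_y (mk (b, n, 0%N)).
Proof. by rewrite /face_step mk_x /= ?prednK // eqxx. Qed.

(** Walking along a face jumps over the loops, two darts at a time. *)
Lemma same_face_even b n i k : ~~ odd i -> ~~ (b && (i < 2)%N) ->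
  (i + k.*2 < p)%N -> same_face (mk (b, n, i)) (mk (b, n, i + k.*2)%N).
Proof.
move=> ei bi; elim: k => [|k IH] ikp; first by rewrite addn0; exact: same_face_refl.
apply: same_face_trans (IH _) _; first lia.
apply: same_face_step; rewrite face_step_succ; last lia.
rewrite mk_y /=; last lia.
rewrite ifF; last by apply: contraNF bi => /andP[->]; lia.
rewrite ifT; last lia.
by congr (mk (_, _, _)); lia.
Qed.

Lemma same_face_around b n i : ~~ odd i -> ~~ (b && (i < 2)%N) -> (i < p)%N ->
  same_face (mk (b, n, i)) (dart_y (mk (b, n, 0%N))).
Proof.
move=> ei bi ip; have := @same_face_even b n i (p.-1 - i)./2 ei bi.
have -> : (i + (p.-1 - i)./2.*2)%N = p.-1 by lia.
rewrite prednK // leqnn => /(_ isT) /same_face_trans; apply.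
exact/same_face_step/face_step_last.
Qed.

(** The walk enters a leaf, passes its loops and comes back. *)
Lemma same_face_leaf n : same_face (mk (false, n.+1, 0%N)) (mk (true, n, side n)).
Proof. by rewrite -[mk (true, _, _)]dart_yK flip_side; exact: same_face_around. Qed.

Lemma same_face_root_leaf : same_face (mk (false, 0%N, 0%N)) (mk (true, 0%N, 0%N)).
Proof.
have -> : mk (true, 0%N, 0%N) = dart_y (mk (false, 0%N, 0%N)) by rewrite mk_y.
exact: same_face_around.
Qed.

Lemma same_face_spine n :
  [/\ same_face (mk (true, n, 0%N)) (mk (true, n.+1, 0%N)),
      same_face (mk (true, n, 1%N)) (mk (true, n, 2%N)) \/
      same_face (mk (true, n, 1%N)) (mk (true, n, 0%N)) &
      same_face (mk (true, n, 0%N)) (mk (false, n.+1, 0%N)) \/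
      same_face (mk (true, n, 2%N)) (mk (false, n.+1, 0%N))].
Proof.
have s01 : same_face (mk (true, n, 0%N)) (dart_y (mk (true, n, 1%N))).
  by apply: same_face_step; rewrite face_step_succ //; lia.
have s12 : same_face (mk (true, n, 1%N)) (dart_y (mk (true, n, 2%N))).
  by apply: same_face_step; rewrite face_step_succ //; lia.
have := same_face_leaf n; have := flip_up n; have := flip_side n.
rewrite /up /side; case: (eps n) => E1 E2 l; rewrite E1 E2 in s01 s12.
- split=> //.
  + by left; exact: same_face_trans s12 l.
  + by right; exact: same_face_sym.
- have s := same_face_trans s01 l; split; [|right|left] => //.
  + exact: same_face_trans s s12.
  + exact: same_face_sym.
Qed.

(** The face climbs along one side of the spine, through the darts 0, and comes
    down along the other side, entering a vertex by its dart [up n] and leaving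
    it after dart 2 and the loops.  It turns round the leaves on its way, and
    the leaf vertex 0 connects the two sides at the bottom. *)
Lemma same_face_base d : ~~ loop d -> same_face d (mk (true, 0%N, 0%N)).
Proof.
set base := mk _.
have down n : same_face (mk (true, n, 0%N)) base.
  elim: n => [|n IH]; first exact: same_face_refl.
  by have [s _ _] := same_face_spine n; exact: same_face_trans (same_face_sym s) IH.
have one n : same_face (mk (true, n, 2%N)) base ->
    same_face (mk (true, n, 1%N)) base.
  move=> s2; have [_ [s|s] _] := same_face_spine n; apply: same_face_trans s _ => //.
have two n : same_face (mk (true, n, 2%N)) base.
  elim: n => [|n IH].
    apply: same_face_trans (same_face_around _ _ _ _) _ => //.
    by rewrite mk_y //; exact: same_face_root_leaf.
  apply: same_face_trans (same_face_around _ _ _ _) _ => //.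
  rewrite -flip_up dart_yK /up; case: ifP => // _; exact: one.
have leaf n : same_face (mk (false, n, 0%N)) base.
  case: n => [|n]; first exact: same_face_root_leaf.
  apply: same_face_trans (same_face_leaf n) _; rewrite /side; case: ifP => // _.
  exact: one.
elim/dart_elim: d => b n i ip; rewrite loop_mk // negb_and negbK.
have [ei _|/negPn oi] := boolP (~~ odd i); last first.
  move=> /andP[-> i2]; have -> : i = 1%N by lia.
  exact: one.
case: b => /=; last first.
  apply: same_face_trans (leaf n); apply: same_face_sym.
  have := @same_face_even false n 0 i./2 isT isT.
  have -> : (0 + i./2.*2)%N = i by lia.
  exact.
case: i ei ip => [//|[//|i]] ei ip.
apply: same_face_trans (two n); apply: same_face_sym.
have := @same_face_even true n 2 i./2 isT isT.
have -> : (2 + i./2.*2)%N = i.+2 by lia.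
exact.
Qed.

Lemma caterpillar_one_face d d' : ~~ loop d -> ~~ loop d' ->
  exists m n, iter m W d = iter n W d'.
Proof.
move=> /same_face_base s /same_face_base s'.
exact: same_face_trans s (same_face_sym s').
Qed.

Hypothesis long_runs : forall r, exists n, forall i, (i < r)%N -> eps (n + i).

(** Where eps is true the walk passes from dart 0 of a spine vertex directly to
    dart 0 of the next one. *)
Lemma caterpillar_long_run r : exists2 d, ~~ loop d &
  forall i, (i < r)%N -> ~~ loop (x' (iter i W d)).
Proof.
have [n run] := long_runs r; exists (mk (true, n, 0%N)); first exact: nonloop_down.
suff H i : (i <= r)%N -> iter i W (mk (true, n, 0%N)) = mk (true, (n + i)%N, 0%N).
  by move=> i /ltnW/H ->; exact: nonloop_last.
elim: i => [|i IH] ir; first by rewrite addn0.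
rewrite iterS IH 1?ltnW // face_step_succ; last lia.
by have := flip_up (n + i)%N; rewrite /up run // addnS.
Qed.

Lemma caterpillar_has_loop n : loop (mk (false, n, 1%N)).
Proof. by rewrite loop_mk //; lia. Qed.

Definition caterpillar_group : set (hecke p) :=
  stabiliser dart_x dart_y dart_base.

Lemma caterpillar_group_maximal : maximal_subgroup caterpillar_group.
Proof.
apply: (stabiliser_maximal p_gt0 dart_xp dart_yK dart_xx_neq dart_path_base
  dart_path_x dart_path_y caterpillar_tree_ind).
- exists (mk (false, 0%N, 1%N)); exact: caterpillar_has_loop.
- exact: caterpillar_one_face.
- exact: caterpillar_long_run.
Qed.

Lemma caterpillar_group_torsion_free : torsion_free caterpillar_group.
Proof.
exact: (stabiliser_torsion_free p_gt0 dart_xp dart_yK dart_xx_neq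
  dart_path_base dart_path_x dart_path_y caterpillar_tree_ind).
Qed.

Lemma caterpillar_group_free : exists T : set (hecke p),
  [/\ T `<=` hecke_parabolic (p := p), T #= [set: nat] &
      freely_generated caterpillar_group T].
Proof.
exists (loop_elts dart_x dart_y dart_path); split.
- apply: (loop_elts_parabolic p_gt0 dart_xp dart_yK).
  by exists (mk (true, 0%N, 0%N)); exact: nonloop_down.
- rewrite card_eq_le; apply/andP; split; first exact: hecke_countable.
  pose g n := loop_elt dart_path (mk (false, n, 1%N)).
  have g_inj : injective g.
    move=> m n /(loop_elt_inj p_gt0 dart_xp dart_yK dart_xx_neq dart_path_base
      dart_path_x dart_path_y caterpillar_tree_ind (caterpillar_has_loop m)
      (caterpillar_has_loop n)) /eqP.
    rewrite mk_eq /=; [|lia|lia].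
    by move=> /eqP[].
  have := @inj_card_eq _ _ [set: nat] g (in2W g_inj).
  rewrite card_eq_le => /andP[_] /card_le_trans; apply.
  apply: subset_card_le => _ [n _ <-]; exists (mk (false, n, 1%N)) => //.
  exact: caterpillar_has_loop.
- exact: (stabiliser_free p_gt0 dart_xp dart_yK dart_xx_neq dart_path_base
    dart_path_x dart_path_y caterpillar_tree_ind).
Qed.

Local Notation act := (hecke_act dart_x dart_y).

(** From dart 0 of a spine vertex, X Y leads to dart 0 of a spine vertex or of a
    leaf vertex, and the next dart is a loop only in the latter case. *)
Lemma act_spine_leaf g n : act dart_base g = mk (true, n, 0%N) ->
  loop (act dart_base (g * X * Y * X)) = ~~ eps n.
Proof.
move=> E; rewrite !(hecke_actM p_gt0 dart_xp dart_yK) E.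
rewrite !(hecke_actX p_gt0 dart_xp dart_yK) (hecke_actY p_gt0 dart_xp dart_yK).
rewrite mk_x //= ifF; last by apply/eqP; lia.
rewrite mk_y; last by rewrite /=; lia.
rewrite flip_spine // /up; case: (eps n) => /=; rewrite mk_x //= ifF ?loop_mk //.
all: by [lia|apply/eqP; lia].
Qed.

Lemma act_spine_succ g n : act dart_base g = mk (true, n, 0%N) ->
  act dart_base (g * X ^+ up n * Y) = mk (true, n.+1, 0%N).
Proof.
move=> E; rewrite !(hecke_actM p_gt0 dart_xp dart_yK) E.
rewrite (hecke_actY p_gt0 dart_xp dart_yK) -flip_up; congr dart_y.
rewrite -[up n in RHS]add0n -dart_x_iter ?up_lt //.
elim: (up n) => [|k IH]; first by rewrite hecke_act1 //; [exact: dart_xp|exact: dart_yK].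
by rewrite expgSr (hecke_actM p_gt0 dart_xp dart_yK) IH
  (hecke_actX p_gt0 dart_xp dart_yK).
Qed.

(** Being a loop is visible in the stabiliser, since X and Y then have the same
    effect. *)
Lemma loop_act_group h : loop (act dart_base h) <->
  caterpillar_group (h * X * Y * h^-1).
Proof.
have actM := hecke_actM p_gt0 dart_xp dart_yK.
have actK := hecke_actK p_gt0 dart_xp dart_yK.
rewrite /caterpillar_group /stabiliser /= !actM.
rewrite (hecke_actX p_gt0 dart_xp dart_yK) (hecke_actY p_gt0 dart_xp dart_yK).
set d := act dart_base h; split=> [/eqP->|].
  by rewrite dart_yK actK.
rewrite -[RHS](actK h dart_base) /= -/d => /(hecke_act_inj p_gt0 dart_xp dart_yK) E.
by apply/eqP; rewrite -{2}E dart_yK.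
Qed.

End Caterpillar.

(** * Uncountably many conjugacy classes *)

(** By induction on n, one word of Gamma leads to the n-th spine vertex in both
    trees; the common stabiliser then decides the n-th bit. *)
Lemma caterpillar_group_inj p (p_ge3 : (3 <= p)%N) (p_odd : odd p) eps eps' :
  caterpillar_group eps p_ge3 p_odd = caterpillar_group eps' p_ge3 p_odd ->
  eps =1 eps'.
Proof.
move=> E; have p_gt0 : (0 < p)%N by lia.
pose reaches (e : nat -> bool) (g : hecke p) n :=
  hecke_act (dart_x p_ge3 p_odd) (dart_y e p_ge3 p_odd) (dart_base p_ge3) g =
  mk p_ge3 (true, n, 0%N).
have same g n : reaches eps g n -> reaches eps' g n -> eps n = eps' n.
  move=> /act_spine_leaf l /act_spine_leaf l'; apply: negb_inj.
  rewrite -l -l'; apply/idP/idP => /loop_act_group H; apply/loop_act_group.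
  - by rewrite -E.
  - by rewrite E.
suff H n : exists g, reaches eps g n /\ reaches eps' g n.
  by move=> n; have [g [Eg Eg']] := H n; exact: same Eg Eg'.
elim: n => [|n [g [Eg Eg']]].
  exists 1; rewrite /reaches !hecke_act1 //; try exact: dart_xp; try exact: dart_yK.
  by rewrite -[mk _ _]/(mk p_ge3 (val (dart_base p_ge3))) mk_val.
exists (g * heckeX p ^+ up eps n * heckeY p); split; first exact: act_spine_succ.
have -> : up eps n = up eps' n by rewrite /up (same g n).
exact: act_spine_succ.
Qed.

(** Cantor's diagonal argument. *)
Lemma binary_sequences_uncountable (T : Type) (A : set T)
    (F : (nat -> bool) -> T) :
  injective F -> (forall b, A (F b)) -> ~ countable A.
Proof.
move=> F_inj FA /countable_injP[f f_inj].
have k_inj : injective (f \o F).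
  by move=> b c /= E; apply: F_inj; apply: f_inj; rewrite ?inE.
pose diag n := ~~ `[< exists b, f (F b) = n /\ b n >].
have [dn|] := boolP (diag (f (F diag))).
  by case/negP: (dn); apply/asboolP; exists diag.
by move=> /[dup] nd /negPn/asboolP[b [/k_inj -> bn]]; rewrite bn in nd.
Qed.

(** Bits chosen freely at the powers of 2 and set to true elsewhere: the gaps
    between powers of 2 provide the long runs. *)
Definition sparse (b : nat -> bool) (n : nat) : bool :=
  (n != 2 ^ trunc_log 2 n)%N || b (trunc_log 2 n).

Lemma sparse_inj b c : sparse b =1 sparse c -> b = c.
Proof.
move=> E; apply/funext => n; have := E (2 ^ n)%N.
by rewrite /sparse trunc_expnK // eqxx.
Qed.

Lemma sparse_long_runs b r : exists n, forall i, (i < r)%N -> sparse b (n + i).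
Proof.
exists (2 ^ r).+1 => i ir; have r2 := ltn_expl r (isT : (1 < 2)%N).
rewrite /sparse (@trunc_log_eq 2 r) //; first by apply/orP; left; lia.
by rewrite expnS; lia.
Qed.

Theorem theorem7 (p : nat) (p_ge3 : (3 <= p)%N) (p_odd : odd p) :
  isomorphic (hecke p) (free_product (cyclic_group p) (cyclic_group 2)) /\
  ~ countable [set conjugacy_class M | M in
      [set M : set (hecke p) |
        [/\ maximal_subgroup M, torsion_free M &
            exists T : set (hecke p),
              [/\ T `<=` hecke_parabolic (p := p), T #= [set: nat] &
                  freely_generated M T]]]].
Proof.
split; first by apply: hecke_isomorphic; exact: ltnW.
set Ms := [set M : set (hecke p) | _] => cC.
have mem_class M : conjugacy_class M M.
  exists 1 => //; apply/seteqP; split=> [g [h Mh <-]|g Mg]; rewrite ?conjg1 //.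
  by exists g => //; rewrite conjg1.
apply: (@binary_sequences_uncountable _ Ms
  (fun b => caterpillar_group (sparse b) p_ge3 p_odd)).
- by move=> b c /caterpillar_group_inj/sparse_inj.
- move=> b; split.
  + exact/caterpillar_group_maximal/sparse_long_runs.
  + exact: caterpillar_group_torsion_free.
  + exact: caterpillar_group_free.
- have cU : countable (\bigcup_(C in [set conjugacy_class M | M in Ms]) C).
    apply: bigcup_countable => // _ [M _ <-].
    by apply: sub_countable (card_image_le _ _) _; exact: hecke_countable.
  apply: sub_countable cU; apply: subset_card_le => M MsM.
  by exists (conjugacy_class M) => //; exists M.
Qed.
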